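(* Let $X$ be a Banach space over $\mathbb F$, where $\mathbb F=\mathbb R$ or $\mathbb F=\mathbb C$, and let $\mathcal A\subseteq B(X)$ be a standard operator algebra, i.e. a subalgebra of $B(X)$ containing every finite rank operator in $B(X)$. Then every 2-local derivation $\delta:\mathcal A\to B(X)$ (not assumed to be linear) is a derivation.
   Context: $B(X)$ is the algebra of all bounded linear operators on $X$, and $F(X)\subseteq B(X)$ is the set of bounded operators whose range is finite dimensional. A standard operator algebra on $X$ is a subalgebra $\mathcal A$ of $B(X)$ with $F(X)\subseteq\mathcal A$; it is not assumed to be norm closed or to contain the identity operator. $B(X)$ is regarded as an $\mathcal A$-bimodule via operator multiplication. A derivation from $\mathcal A$ into $B(X)$ is an $\mathbb F$-linear mapping $\delta:\mathcal A\to B(X)$ with $\delta(AB)=\delta(A)B+A\delta(B)$ for all $A,B\in\mathcal A$ (no continuity is assumed). A 2-local derivation from $\mathcal A$ into $B(X)$ is a mapping (not necessarily linear) $\delta:\mathcal A\to B(X)$ such that for all $A,B\in\mathcal A$ there is a derivation $\delta_{A,B}:\mathcal A\to B(X)$ (depending on $A$ and $B$) with $\delta(A)=\delta_{A,B}(A)$ and $\delta(B)=\delta_{A,B}(B)$. *)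

(* Defs.v *)
From HB Require Import structures.
From mathcomp Require Import all_boot all_order all_algebra.
From mathcomp Require Import complex.
From mathcomp Require Import all_classical all_reals all_analysis.

Set Implicit Arguments.
Unset Strict Implicit.
Unset Printing Implicit Defensive.

Import Order.TTheory GRing.Theory Num.Theory.
Import numFieldNormedType.Exports.

Local Open Scope classical_set_scope.
Local Open Scope ring_scope.

(* Operators on X are plain functions X -> X: sums and scalar multiples are the
   pointwise ones, the product is composition, and the operators of a given
   class form a set of functions. *)

Section OperatorAlgebras.
Context {K : numFieldType} {X : normedModType K}.
Implicit Types (A B : X -> X) (S : set (X -> X)).

Definition bounded_operators : set (X -> X) :=
  [set A | linear A /\ exists M : K, forall x, `|A x| <= M * `|x|].

Definition finite_dimensional (V : set X) : Prop :=
  exists (n : nat) (e : 'I_n -> X),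
    V = [set \sum_(i < n) c i *: e i | c in [set: 'I_n -> K]].

Definition finite_rank_operators : set (X -> X) :=
  [set A | bounded_operators A /\ finite_dimensional (range A)].

Definition operator_subalgebra S : Prop :=
  [/\ S `<=` bounded_operators,
      S (fun=> 0),
      forall A B, S A -> S B -> S (A + B),
      forall (a : K) A, S A -> S (a *: A) &
      forall A B, S A -> S B -> S (A \o B)].

Definition standard_operator_algebra S : Prop :=
  operator_subalgebra S /\ finite_rank_operators `<=` S.

(* A mapping S -> B(X) is represented by a function on all of X -> X of which
   only the values on S matter. *)
Definition maps_into_bounded S (delta : (X -> X) -> (X -> X)) : Prop :=
  forall A, S A -> bounded_operators (delta A).

Definition derivation S (delta : (X -> X) -> (X -> X)) : Prop :=
  [/\ maps_into_bounded S delta,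
      forall A B, S A -> S B -> delta (A + B) = delta A + delta B,
      forall (a : K) A, S A -> delta (a *: A) = a *: delta A &
      forall A B, S A -> S B ->
        delta (A \o B) = (delta A \o B) + (A \o delta B)].

Definition two_local_derivation S (delta : (X -> X) -> (X -> X)) : Prop :=
  maps_into_bounded S delta /\
  forall A B, S A -> S B ->
    exists D : (X -> X) -> (X -> X),
      [/\ derivation S D, delta A = D A & delta B = D B].

End OperatorAlgebras.

(* Main.v *)
Require Import Defs.
From HB Require Import structures.
From mathcomp Require Import all_boot all_order all_algebra.
From mathcomp Require Import complex.
From mathcomp Require Import all_classical all_reals all_analysis.
From mathcomp Require Import ring lra.

(** Let E = x (x) f with f x = 1 be a rank-one idempotent. A derivation D that
    agrees with delta at A and E, applied to E A E = f(A x) E, expresses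
    f(delta(A) x) through delta(E), additively in A; Hahn-Banach then makes
    delta additive, and homogeneity only involves the pair A, a A. Next,
    (A - A E) E = 0 and (A E) E = A E are again relations between two elements
    of the algebra, so delta(A E) = delta(A) E + A delta(E); this extends to all
    rank-one operators, which are combinations of two such idempotents.
    Expanding delta(A B E) in two ways gives the Leibniz rule for A, B. *)

Import Order.TTheory GRing.Theory Num.Theory.
Import numFieldNormedType.Exports.

Local Open Scope classical_set_scope.
Local Open Scope ring_scope.

(** * Bounded functionals and maximal convex cones *)

Definition bounded_functional {K : numFieldType} {X : normedModType K}
    (f : X -> K) :=
  scalar f /\ exists M : K, forall x, `|f x| <= M * `|x|.

Definition convex_cone {R : realType} {W : lmodType R} (C : set W) : Prop :=
  [/\ C 0, forall u v, C u -> C v -> C (u + v) &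
      forall (t : R) u, 0 < t -> C u -> C (t *: u)].

(* The last clause is how maximality is used: adjoining [z] to [C] produces [p]. *)
Lemma maximal_convex_cone {R : realType} {W : lmodType R} (C0 : set W) (p : W) :
  convex_cone C0 -> ~ C0 p ->
  exists C, [/\ convex_cone C, C0 `<=` C, ~ C p &
    forall z, ~ C z -> exists (t : R) (e : W), [/\ 0 < t, C e & p = e + t *: z]].
Proof.
move=> [C00 C0D C0Z] C0p.
(* The conditions are imposed on the union with [C0], so that the empty chain, whose union is empty,
   satisfies them too. *)
pose P (A : set W) := convex_cone (A `|` C0) /\ ~ (A `|` C0) p.
have [|A [[[A0 AD AZ] Ap] Amax]] := @Zorn_bigcup W P.
  move=> F FP Ftot; split; last first.
    by move=> [[A FA Ap]|//]; have [_] := FP _ FA; apply; left.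
  have Fcommon u v : (\bigcup_(A in F) A `|` C0) u ->
      (\bigcup_(A in F) A `|` C0) v ->
      (C0 u /\ C0 v) \/
      exists2 A, F A & (A `|` C0) u /\ (A `|` C0) v.
    move=> [[A FA Au]|C0u] [[B FB Bv]|C0v]; last by left.
    - right; have [AB|BA] := Ftot _ _ FA FB.
        by exists B => //; split; left => //; exact: AB.
      by exists A => //; split; left => //; exact: BA.
    - by right; exists A => //; split; [left|right].
    - by right; exists B => //; split; [right|left].
  have FU B : F B -> B `|` C0 `<=` \bigcup_(A in F) A `|` C0.
    by move=> FB u [Bu|C0u]; [left; exists B|right].
  split; first by right.
    move=> u v Uu Uv; have [[C0u C0v]|[B FB [Bu Bv]]] := Fcommon _ _ Uu Uv.
      by right; exact: C0D.
    by apply: (FU _ FB); have [[_ BD _] _] := FP _ FB; exact: BD.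
  move=> t u t0 Uu; have [[C0u _]|[B FB [Bu _]]] := Fcommon _ _ Uu Uu.
    by right; exact: C0Z.
  by apply: (FU _ FB); have [[_ _ BZ] _] := FP _ FB; exact: BZ.
exists (A `|` C0); split; [by split|by move=> u C0u; right|exact: Ap|].
move=> z Az.
(* The cone generated by [A], [C0] and [z]. If it misses [p], it contradicts the maximality of [A];
   if it contains [p], then [t = 0] is excluded because [p] lies outside the smaller cone. *)
pose B := [set u : W | exists (t : R) (e : W),
  [/\ 0 <= t, (A `|` C0) e & u = e + t *: z]].
have AB : A `|` C0 `<=` B.
  by move=> u Au; exists 0, u; split => //; rewrite scale0r addr0.
have BE : B `|` C0 = B by apply/setUidl => u C0u; apply: AB; right.
have [[t [e [t0 Ae pE]]]|Bp] := pselect (B p).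
  exists t, e; split => //; rewrite lt_neqAle t0 andbT; apply/eqP => t0'.
  by apply: Ap; rewrite pE -t0' scale0r addr0.
exfalso; apply: (Amax B).
  split; first by move=> u Au; apply: AB; left.
  move=> /(_ z) BA; apply: Az; left; apply: BA.
  by exists 1, 0; split => //; rewrite add0r scale1r.
rewrite /P BE; split => //; split; first exact: AB.
  move=> _ _ [t [e [t0 Ae ->]]] [s [e' [s0 Ae' ->]]].
  exists (t + s), (e + e'); split; [exact: addr_ge0|exact: AD|].
  by rewrite scalerDl addrACA.
move=> s _ s0 [t [e [t0 Ae ->]]]; exists (s * t), (s *: e).
by split; [rewrite mulr_ge0// ltW|exact: AZ|rewrite scalerDr scalerA].
Qed.

(** * Hahn-Banach over the reals: a norming functional for a seminorm *)

Section HahnBanach.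
Context {R : realType} {V : lmodType R} (N : V -> R).
Hypothesis ND : forall x y, N (x + y) <= N x + N y.
Hypothesis NZ : forall (t : R) x, N (t *: x) = `|t| * N x.

(* [C] is a maximal convex cone of V x R that contains the epigraph of [N] and
   [(- x0, - N x0)] but not [(0, -1)]; it is a half-space, the epigraph of the
   functional. *)
Lemma hahn_banach_norming (x0 : V) :
  exists f : V -> R, [/\ scalar f, forall x, `|f x| <= N x & f x0 = N x0].
Proof.
have N0 : N 0 = 0 by rewrite -[0](scale0r 0) NZ normr0 mul0r.
pose W : lmodType R := (V * R^o)%type.
(* These are the points of the epigraph of [N] translated by [t] times [(- x0, - N x0)]. *)
pose C0 := [set u : W | exists2 t : R, 0 <= t &
  N (u.1 + t *: x0) <= u.2 + t * N x0].
have [||C [[C_0 CD CZ] C0C Cp Cmax]] := @maximal_convex_cone R W C0 (0, -1).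
- split.
  + by exists 0 => //=; rewrite scale0r mul0r !addr0 N0.
  + move=> [x r] [y s] [t t0 /= xr] [t' t'0 /= ys].
    exists (t + t'); rewrite ?addr_ge0//=.
    rewrite scalerDl addrACA (le_trans (ND _ _))// mulrDl addrACA.
    exact: lerD.
  + move=> t [x r] t0 [s s0 /= xr]; exists (t * s); first by rewrite mulr_ge0// ltW.
    rewrite /= -scalerA -scalerDr NZ gtr0_norm// -mulrA -mulrDr.
    by rewrite ler_pM2l.
- move=> [t t0 /=]; rewrite add0r NZ ger0_norm// -lerBlDr subrr.
  by rewrite ler0N1.
have CN x : C (x, N x).
  by apply: C0C; exists 0 => //=; rewrite scale0r mul0r !addr0.
have Cge0 r : C (0, r) -> 0 <= r.
  move=> Cr; rewrite leNgt; apply/negP => r0; apply: Cp.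
  have := CZ (- r)^-1 (0, r).
  rewrite invr_gt0 oppr_gt0 => /(_ r0 Cr).
  rewrite [_ *: _](_ : _ = ((- r)^-1 *: 0, (- r)^-1 * r))// scaler0.
  by rewrite invrN mulNr mulVf// lt_eqF.
have Cpos r : 0 <= r -> C (0, r).
  by move=> r0; apply: C0C; exists 0 => //=; rewrite scale0r mul0r !addr0 N0.
(* Maximality gives [(0, -1) = e + t (x, r)] with [e] in [C]; then [e / t = (- x, - r - 1 / t)], and
   adding [(0, 1 / t)] yields [(- x, - r)]. *)
have CN' x r : ~ C (x, r) -> C (- x, - r).
  move=> /Cmax[t [[y s] [t0 Ce]]].
  rewrite [_ + _](_ : _ = (y + t *: x, s + t * r))// => -[/esym y0 /esym s1].
  have := CD _ _ (CZ t^-1 _ _ Ce) (Cpos t^-1 _).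
  rewrite invr_gt0 invr_ge0 (ltW t0) => /(_ t0 isT).
  rewrite [_ + _](_ : _ = (t^-1 *: y + 0, t^-1 * s + t^-1))//.
  rewrite -(addr0_eq (etrans (addrC _ _) y0)) addr0 scalerN scalerA mulVf ?gt_eqF//.
  rewrite scale1r (_ : _ + t^-1 = - r)//.
  have -> : s = -1 - t * r by rewrite -s1 addrK.
  by field; rewrite gt_eqF.
pose f x := inf [set r | C (x, r)].
have hinf x : has_inf [set r | C (x, r)].
  split; first by exists (N x).
  (* Adding [(- x, N (- x))] to [(x, r)] lands on the axis, where [C] has only nonnegative
     heights. *)
  exists (- N (- x)) => r /= Cr; rewrite -subr_ge0 opprK; apply: Cge0.
  by rewrite -(subrr x); apply: (CD _ _ Cr (CN _)).
have f_le x r : C (x, r) -> f x <= r by apply: ge_inf; case: (hinf x).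
have f_ge x a : (forall r, C (x, r) -> a <= r) -> a <= f x.
  by move=> h; apply: lb_le_inf => //; case: (hinf x).
have fD_le x y : f (x + y) <= f x + f y.
  rewrite -lerBlDr; apply: (f_ge) => r Cr; rewrite lerBlDr -lerBlDl.
  by apply: f_ge => s Cs; rewrite lerBlDl; apply: f_le; exact: (CD _ _ Cr Cs).
have fN_le x : f (- x) <= - f x.
  rewrite leNgt; apply/negP => fx.
  (* If [f x + f (- x) > 0], this height [r] is below [f x] and [- r] is below [f (- x)], so neither
     [(x, r)] nor [(- x, - r)] could lie in [C]. *)
  have [Cr|/CN' Cr] := pselect (C (x, (f x - f (- x)) / 2)).
    by have := f_le _ _ Cr; lra.
  by have := f_le _ _ Cr; lra.
have f0 : f 0 = 0.
  by apply/eqP; rewrite eq_le f_le//= f_ge.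
have fN x : f (- x) = - f x.
  apply/eqP; rewrite eq_le fN_le/= -subr_ge0 opprK -f0.
  by rewrite -{1}(addNr x).
have fD x y : f (x + y) = f x + f y.
  apply/eqP; rewrite eq_le fD_le/= -lerBrDr -fN.
  by rewrite -{1}(addrK y x).
have fZ_le t x : 0 < t -> f (t *: x) <= t * f x.
  move=> t0; rewrite mulrC -ler_pdivrMr//; apply: (f_ge) => r Cr.
  by rewrite ler_pdivrMr// mulrC; apply: f_le; exact: (CZ _ _ t0 Cr).
have fZ_gt0 t x : 0 < t -> f (t *: x) = t * f x.
  move=> t0; apply/eqP; rewrite eq_le fZ_le//= -ler_pdivlMl//.
  rewrite -{1}(scale1r x) -(mulVf (lt0r_neq0 t0)) -scalerA.
  by rewrite fZ_le ?invr_gt0.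
have fZ t x : f (t *: x) = t * f x.
  have [t0|t0|->] := ltgtP t 0; last by rewrite scale0r mul0r.
    by rewrite -{1}[t]opprK scaleNr fN fZ_gt0 ?oppr_gt0// mulNr opprK.
  exact: fZ_gt0.
have fN_N x : f x <= N x by exact: f_le.
have f_norm x : `|f x| <= N x.
  rewrite ler_norml fN_N andbT lerNl -fN (le_trans (fN_N _))//.
  by rewrite -scaleN1r NZ normrN1 mul1r.
exists f; split => //; first by move=> a x y; rewrite fD fZ.
(* The ray through [(- x0, - N x0)] was put into [C0] for this: it forces [f (- x0) <= - N x0]. *)
apply/eqP; rewrite eq_le fN_N/= -lerN2 -fN; apply/f_le/C0C.
by exists 1 => //=; rewrite scale1r mul1r !addNr N0.
Qed.

End HahnBanach.

Lemma real_separation {R : realType} {X : normedModType R} (x : X) :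
  x != 0 -> exists2 f : X -> R, bounded_functional f & f x = 1.
Proof.
move=> x0.
have [f [lf fN fx]] := @hahn_banach_norming R X _ (@ler_normD _ X) (@normrZ _ X) x.
exists (fun y => `|x|^-1 * f y); last by rewrite fx mulVf// normr_eq0.
split; first by move=> a u v; rewrite lf mulrDr mulrCA.
exists `|x|^-1 => y.
by rewrite normrM ger0_norm ?invr_ge0// ler_wpM2l ?invr_ge0.
Qed.

(** * Separation over the complex numbers *)

Section Realification.
Local Open Scope complex_scope.
Context {R : realType} {X : normedModType R[i]}.

(** A separate name for [X], so that the real scalar action does not compete with the complex
    one. *)
Definition realification : Type := X.

HB.instance Definition _ := GRing.Zmodule.on realification.

Let scaler (t : R) (x : realification) : realification := t%:C *: (x : X).

Let realification_scalerA a b v : scaler a (scaler b v) = scaler (a * b) v.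
Proof. by rewrite /scaler scalerA -rmorphM. Qed.

Let scaler1 : left_id 1 scaler.
Proof. by move=> v; rewrite /scaler rmorph1 scale1r. Qed.

Let realification_scalerDr : right_distributive scaler +%R.
Proof. by move=> a u v; rewrite /scaler scalerDr. Qed.

Let realification_scalerDl v : {morph scaler^~ v : a b / a + b}.
Proof. by move=> a b; rewrite /scaler rmorphD scalerDl. Qed.

HB.instance Definition _ := GRing.Zmodule_isLmodule.Build R realification
  realification_scalerA scaler1 realification_scalerDr realification_scalerDl.

(* A complex functional is recovered from its real part [u] as
   [u y - i u (i y)]. *)
Lemma complex_separation (x : X) :
  x != 0 -> exists2 f : X -> R[i], bounded_functional f & f x = 1.
Proof.
move=> x0.
(* The norm of [X] takes values in [R[i]]; its real part is the same norm with values in [R]. *)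
pose N (y : realification) : R := complex.Re `|y : X|.
have NE y : (N y)%:C = `|y : X| by rewrite RRe_real// normr_real.
have ND y z : N (y + z) <= N y + N z.
  by rewrite -lecR rmorphD/= !NE (@ler_normD _ X).
have NZ (t : R) y : N (t *: y) = `|t| * N y.
  apply: (@complexI R); rewrite rmorphM/= !NE.
  rewrite [LHS](_ : _ = `|t%:C *: (y : X)|)// normrZ; congr (_ * _).
  by rewrite normc_def /= expr0n addr0 sqrtr_sqr.
have [u [lu uN ux]] := @hahn_banach_norming R realification N ND NZ x.
pose g (y : X) : R[i] := (u y)%:C - 'i%C * (u ('i%C *: y))%:C.
have uD y z : u (y + z) = u y + u z by rewrite -{1}[y]scale1r lu mul1r.
have u0 : u 0 = 0 by apply: (addrI (u 0)); rewrite -uD !addr0.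
have uZ (t : R) (y : X) : u (t%:C *: y) = t * u y.
  by have := lu t y 0; rewrite !addr0 u0 addr0.
have gD y z : g (y + z) = g y + g z.
  by rewrite /g scalerDr !uD !rmorphD/=; ring.
have gR (t : R) y : g (t%:C *: y) = t%:C * g y.
  by rewrite /g scalerA [_ * t%:C]mulrC -scalerA !uZ !rmorphM/=; ring.
have ii : 'i%C * 'i%C = -1 :> R[i] by rewrite -expr2 sqr_i.
have gI y : g ('i%C *: y) = 'i%C * g y.
  rewrite /g scalerA ii -(rmorphN1 (real_complex R)) uZ mulN1r rmorphN/=.
  by rewrite mulrBr mulrA ii mulN1r mulrN !opprK addrC.
have lg : scalar g.
  move=> a y z; rewrite gD; congr (_ + _).
  by rewrite [a]complexE scalerDl gD -scalerA gI !gR mulrDl mulrA.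
(* The real part of [g x] is [u x = N x], the norm of [x]. *)
have gx : g x != 0.
  apply: contra_neq x0 => /(congr1 (@complex.Re R)).
  rewrite /g /= !mul0r !mul1r subr0 oppr0 addr0 ux => Nx.
  by apply/normr0_eq0; rewrite -NE Nx.
exists (fun y => (g x)^-1 * g y); last by rewrite mulVf.
split; first by move=> a y z; rewrite lg mulrDr mulrCA.
have normu y : `|(u y)%:C| <= `|y : X|.
  by rewrite normc_def /= expr0n addr0 sqrtr_sqr -NE lecR.
(* The factor 2 counts the two terms of [g y], each bounded by the norm of [y]. *)
exists (`|(g x)^-1| * 2) => y; rewrite normrM -mulrA ler_wpM2l//.
rewrite (le_trans (ler_normB _ _))// mulr_natl mulr2n lerD// normrM.
have normi : `|'i%C| = 1 :> R[i].
  by rewrite normc_def /= expr0n expr1n add0r sqrtr1.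
by rewrite normi mul1r (le_trans (normu _))// normrZ normi mul1r.
Qed.

End Realification.

(** * 2-local derivations tested on rank-one operators *)

Section TwoLocal.
Context {K : numFieldType} {X : normedModType K}.
Implicit Types (A B E : X -> X) (S : set (X -> X)) (f g : X -> K).

Definition rank_one (x : X) f : X -> X := fun y => f y *: x.

Lemma linD {A} : linear A -> {morph A : x y / x + y}.
Proof. by move=> lA x y; rewrite -{1}[x]scale1r lA scale1r. Qed.

Lemma lin0 {A} : linear A -> A 0 = 0.
Proof. by move=> lA; rewrite -{1}[0](subrr 0) -scaleN1r addrC lA scaleN1r addNr. Qed.

Lemma linZ {A} : linear A -> forall a, {morph A : x / a *: x}.
Proof. by move=> lA a x; rewrite -[a *: x]addr0 lA (lin0 lA) addr0. Qed.

Lemma scalD {f} : scalar f -> {morph f : x y / x + y}.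
Proof. by move=> lf x y; rewrite -{1}[x]scale1r lf mul1r. Qed.

Lemma scal0 {f} : scalar f -> f 0 = 0.
Proof. by move=> lf; rewrite -{1}[0](subrr 0) -scaleN1r addrC lf mulN1r addNr. Qed.

Lemma scalZ {f} : scalar f -> forall a x, f (a *: x) = a * f x.
Proof. by move=> lf a x; rewrite -[a *: x]addr0 lf (scal0 lf) addr0. Qed.

Lemma bounded_functionalDZ f g (c : K) : bounded_functional f ->
  bounded_functional g -> bounded_functional (fun x => f x + c * g x).
Proof.
move=> [lf [M hM]] [lg [N hN]]; split.
  by move=> a x y; rewrite lf lg !mulrDr addrACA (mulrCA c).
exists (M + `|c| * N) => x.
rewrite mulrDl (le_trans (ler_normD _ _))// lerD// normrM -mulrA.
by rewrite ler_wpM2l.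
Qed.

(** The point [y] makes [f] surjective, so the range is the full span of [x], as the set equality in
    [finite_dimensional] demands. *)
Lemma finite_rank_rank_one (x y : X) f : bounded_functional f -> f y = 1 ->
  finite_rank_operators (rank_one x f).
Proof.
move=> [lf [M hM]] fy; split.
  split; first by move=> a u v; rewrite /rank_one lf scalerDl scalerA.
  exists (M * `|x|) => u; rewrite /rank_one normrZ mulrAC.
  by rewrite ler_wpM2r.
exists 1%N, (fun=> x); apply/seteqP; split => z /=.
  by move=> [u _ <-]; exists (fun=> f u) => //; rewrite big_ord1.
move=> [c _ <-]; exists (c ord0 *: y) => //.
by rewrite /rank_one (scalZ lf) fy mulr1 big_ord1.
Qed.

(** Abstracting this consequence of Hahn-Banach lets the real and complex cases share one
    argument. *)
Hypothesis separation :
  forall x : X, x != 0 -> exists2 f, bounded_functional f & f x = 1.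

Variables (S : set (X -> X)) (delta : (X -> X) -> (X -> X)).
Hypotheses (stdS : standard_operator_algebra S)
           (locD : two_local_derivation S delta).

Let SD A B : S A -> S B -> S (A + B).
Proof. by move: stdS => [[_ _ h _ _] _]; apply: h. Qed.

Let SZ a A : S A -> S (a *: A).
Proof. by move: stdS => [[_ _ _ h _] _]; apply: h. Qed.

Let SM A B : S A -> S B -> S (A \o B).
Proof. by move: stdS => [[_ _ _ _ h] _]; apply: h. Qed.

Let S_lin A : S A -> linear A.
Proof. by move: stdS => [[h _ _ _ _] _] /h[]. Qed.

Let delta_lin A : S A -> linear (delta A).
Proof. by move: locD => [h _] /h[]. Qed.

Let S_rank_one x y f : bounded_functional f -> f y = 1 -> S (rank_one x f).
Proof. by move: stdS => [_ h] bf fy; apply/h/(finite_rank_rank_one _ y). Qed.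

Let deltaZ a A : S A -> delta (a *: A) = a *: delta A.
Proof.
move=> SA; move: locD => [_ /(_ A (a *: A) SA (SZ a _ SA))] [D [[_ _ DZ _]]].
by move=> -> ->; rewrite DZ.
Qed.

(* Obtained by applying the derivation that agrees with [delta] at [A] and at
   [E = rank_one x f] to the identity [E A E = f (A x) E]. *)
Let delta_coef A x f : S A -> bounded_functional f -> f x = 1 ->
  let E := rank_one x f in
  f (delta A x) = f (A x) * f (delta E x) - f (delta E (A x)) - f (A (delta E x)).
Proof.
move=> SA bf fx E; have [lf _] := bf.
have SE : S E by exact: S_rank_one fx.
have [_ /(_ A E SA SE)[D [[_ _ DZ DM] dA dE]]] := locD.
have EAE : E \o (A \o E) = f (A x) *: E.
  apply/funext => y; rewrite /E /rank_one /=.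
  by rewrite (linZ (S_lin _ SA)) (scalZ lf) mulrC -scalerA.
have Ex : E x = x by rewrite /E /rank_one fx scale1r.
have := congr1 (fun h => f (h x)) (DM _ _ SE (SM _ _ SA SE)).
rewrite EAE DZ// DM// -dA -dE.
rewrite [RHS](_ : _ = f (delta E (A (E x)) + E (delta A (E x) + A (delta E x))))//.
rewrite [LHS](_ : _ = f (f (A x) *: delta E x))// Ex (scalZ lf) => ->.
rewrite (scalD lf) [E (_ + _)](_ : _ = f (delta A x + A (delta E x)) *: x)//.
rewrite (scalZ lf) (scalD lf) fx mulr1.
by ring.
Qed.

Let deltaD A B : S A -> S B -> delta (A + B) = delta A + delta B.
Proof.
move=> SA SB; apply/funext => x.
have SAB := SD _ _ SA SB.
have [->|x0] := eqVneq x 0.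
  rewrite [RHS](_ : _ = delta A 0 + delta B 0)//.
  rewrite (lin0 (delta_lin _ SAB)) (lin0 (delta_lin _ SA)).
  by rewrite (lin0 (delta_lin _ SB)) addr0.
apply/eqP; rewrite -subr_eq0.
set z := (X in X == 0).
(* For a fixed [f], the right-hand side of [delta_coef] is additive in the operator. *)
have fz f : bounded_functional f -> f x = 1 -> f z = 0.
  move=> bf fx; have [lf _] := bf.
  have -> : z = delta (A + B) x + -1 *: (delta A x + delta B x).
    by rewrite scaleN1r.
  have lE : linear (delta (rank_one x f)).
    by apply/delta_lin/(S_rank_one _ x).
  rewrite (scalD lf) (scalZ lf) (scalD lf).
  rewrite (delta_coef _ _ _ SAB bf fx) (delta_coef _ _ _ SA bf fx).
  rewrite (delta_coef _ _ _ SB bf fx).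
  rewrite [(A + B) x](_ : _ = A x + B x)//.
  set y := delta (rank_one x f) x.
  rewrite [(A + B) y](_ : _ = A y + B y)//.
  rewrite (linD lE) !(scalD lf).
  by ring.
apply/negPn/negP => /separation[f bf fz1].
have [g bg gx] := separation _ x0.
(* The functional [f + (1 - f x) g] has value 1 at [x], so it kills [z]; since [g] kills [z] as
   well, [f z = 0], against [f z = 1]. *)
have := fz _ (bounded_functionalDZ f g (1 - f x) bf bg).
rewrite gx (fz _ bg gx) mulr0 mulr1 addr0 addrC subrK => /(_ erefl).
by rewrite fz1 => /eqP; rewrite oner_eq0.
Qed.

(* [(A - A E) E = 0] and [(A E) E = A E] only involve two elements of [S]. *)
Let deltaM_idem A E : S A -> S E -> E \o E = E ->
  delta (A \o E) = (delta A \o E) + (A \o delta E).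
Proof.
move=> SA SE EE.
have SC := SM _ _ SA SE.
set C := A \o E in SC *.
have SG := SD _ _ SA (SZ (-1) _ SC).
have dC : delta C = (delta C \o E) + (C \o delta E).
  have [_ /(_ C E SC SE)[D [[_ _ _ DM] -> ->]]] := locD.
  by rewrite -DM// /C -compA EE.
have : 0 = (delta (A + -1 *: C) \o E) + ((A + -1 *: C) \o delta E).
  have [_ /(_ _ E SG SE)[D [[_ _ DZ DM] -> ->]]] := locD.
  rewrite -DM//.
  have -> : (A + -1 *: C) \o E = 0 *: C.
    rewrite scale0r; apply/funext => y.
    rewrite [LHS](_ : _ = A (E y) + -1 *: A ((E \o E) y))// EE.
    by rewrite scaleN1r subrr.
  by rewrite DZ// scale0r.
rewrite deltaD// ?deltaZ//; last exact: SZ.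
move=> h; apply/funext => y.
have := congr1 (fun h => h y) h.
rewrite [RHS](_ : _ = delta A (E y) + -1 *: delta C (E y) +
  (A (delta E y) + -1 *: C (delta E y)))// !scaleN1r addrACA -opprD.
have -> : delta C (E y) + C (delta E y) = delta C y.
  by rewrite [in RHS]dC.
by move=> /esym/subr0_eq/esym.
Qed.

Let deltaM_rank_one A x y f : S A -> bounded_functional f -> f y = 1 ->
  delta (A \o rank_one x f) =
  (delta A \o rank_one x f) + (A \o delta (rank_one x f)).
Proof.
move=> SA bf fy; have [lf _] := bf.
have idem z : f z = 1 -> rank_one z f \o rank_one z f = rank_one z f.
  move=> fz; apply/funext => u; rewrite /rank_one /= (scalZ lf).
  by rewrite fz mulr1.
(* [c] is chosen so that [f w = 1]: then [x = w + c y] writes [rank_one x f] through two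
   idempotents, even when [f x = 0]. *)
set c := f x - 1; set w := x + - c *: y.
have fw : f w = 1 by rewrite /w (scalD lf) (scalZ lf) fy mulr1 /c subKr.
have decomp : rank_one x f = rank_one w f + c *: rank_one y f.
  apply/funext => u.
  rewrite [RHS](_ : _ = f u *: w + c *: (f u *: y))// /w scalerDr.
  by rewrite !scalerA mulrN mulrC scaleNr subrK.
have S1 : S (rank_one w f) by exact: S_rank_one fy.
have S2 : S (rank_one y f) by exact: S_rank_one fy.
have -> : A \o rank_one x f = (A \o rank_one w f) + c *: (A \o rank_one y f).
  rewrite decomp; apply/funext => u.
  rewrite [LHS](_ : _ = A (rank_one w f u + c *: rank_one y f u))//.
  by rewrite (linD (S_lin _ SA)) (linZ (S_lin _ SA) c).
have SA1 := SM _ _ SA S1; have SA2 := SM _ _ SA S2.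
rewrite (deltaD _ _ SA1 (SZ c _ SA2)) (deltaZ _ _ SA2).
rewrite (deltaM_idem _ _ SA S1 (idem _ fw)) (deltaM_idem _ _ SA S2 (idem _ fy)).
rewrite decomp (deltaD _ _ S1 (SZ c _ S2)) (deltaZ _ _ S2).
apply/funext => u.
rewrite [RHS](_ : _ = delta A (rank_one w f u + c *: rank_one y f u) +
   A (delta (rank_one w f) u + c *: delta (rank_one y f) u))//.
rewrite (linD (S_lin _ SA)) (linZ (S_lin _ SA) c) (linD (delta_lin _ SA)).
by rewrite (linZ (delta_lin _ SA) c) addrACA -scalerDr.
Qed.

Let deltaM A B : S A -> S B ->
  delta (A \o B) = (delta A \o B) + (A \o delta B).
Proof.
move=> SA SB; apply/funext => x; have SAB := SM _ _ SA SB.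
rewrite [RHS](_ : _ = delta A (B x) + A (delta B x))//.
have [->|x0] := eqVneq x 0.
  rewrite (lin0 (delta_lin _ SAB)) (lin0 (S_lin _ SB)) (lin0 (delta_lin _ SA)).
  by rewrite (lin0 (delta_lin _ SB)) (lin0 (S_lin _ SA)) addr0.
have [f bf fx] := separation _ x0; have [lf _] := bf.
have SE := S_rank_one x x f bf fx.
have BE : B \o rank_one x f = rank_one (B x) f.
  by apply/funext => u; rewrite /= /rank_one (linZ (S_lin _ SB)).
(* With [E = rank_one x f], [h1] splits [A B E] as [A B] times [E], and [h2] as [A] times [B E]. The
   latter factor [rank_one (B x) f] need not be idempotent. Comparing both at [x], which [E] fixes,
   the terms [A (B (delta E x))] cancel. *)
have h1 := deltaM_rank_one _ x x f SAB bf fx.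
have h2 := deltaM_rank_one _ (B x) x f SA bf fx.
rewrite -BE (deltaM_rank_one _ x x f SB bf fx) -compA in h1 h2.
have := congr1 (fun h => h x) (etrans (esym h1) h2).
set E := rank_one x f.
rewrite [LHS](_ : _ = delta (A \o B) (E x) + A (B (delta E x)))//.
rewrite [RHS](_ : _ = delta A (B (E x)) + A (delta B (E x) + B (delta E x)))//.
rewrite (linD (S_lin _ SA)) addrA => /addIr.
by rewrite /E /rank_one fx scale1r.
Qed.

Lemma two_local_derivation_is_derivation : derivation S delta.
Proof.
by split; [case: locD | exact: deltaD | exact: deltaZ | exact: deltaM].
Qed.

End TwoLocal.

Theorem theorem2p4 (R : realType) :
  (forall (X : completeNormedModType R) (S : set (X -> X))
      (delta : (X -> X) -> (X -> X)),
    standard_operator_algebra S ->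
    two_local_derivation S delta -> derivation S delta) /\
  (forall (X : completeNormedModType (complex R)) (S : set (X -> X))
      (delta : (X -> X) -> (X -> X)),
    standard_operator_algebra S ->
    two_local_derivation S delta -> derivation S delta).
Proof.
split=> X S delta; apply: two_local_derivation_is_derivation => x.
  exact: real_separation.
exact: complex_separation.
Qed.
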